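(* Let $D$ be a digraph on $\{1,\dots,n\}$ (as in the context). Then $D$ is invertible if and only if $\Gamma_D$ is bipartite and all prime pairs of $D$ are signable. Similarly, $D$ is simply invertible if and only if $\Gamma_D$ is simple and bipartite and all prime pairs of $D$ are simply signable.
   Context: Digraphs $D$ are finite, with vertex set $\{1,\dots,n\}$, may have multiple edges but no loops, and every directed edge $i\to j$ satisfies $i<j$. Let $B=B_D$ be the $n\times n$ upper unitriangular integer matrix with $B_{i,i}=1$ and $B_{i,j}$ equal to the number of edges from $i$ to $j$ for $i\ne j$; $B^{-1}_{i,j}$ denotes the $(i,j)$ entry of $B^{-1}$. Equivalently $B^{-1}_{i,j}=\sum_P(-1)^{l(P)}$, summed over all directed paths $P$ from $i$ to $j$ in $D$ ($l(P)$ is the length of $P$; paths using different parallel edges are different; for $i=j$ the only path is the one of length $0$). ''Path'' always means directed path. $D$ is invertible if there is a diagonal matrix $S$ with diagonal entries in $\{\pm1\}$ such that $SB^{-1}S=|B^{-1}|$, where $|\cdot|$ is the componentwise absolute value. The parity closure $D^+$ is the digraph on $\{1,\dots,n\}$ with exactly $|B^{-1}_{i,j}|$ edges from $i$ to $j$ for each $i<j$. $D$ is simply invertible if it is invertible and $D^+$ (its inverse) is simple, i.e. has no multiple edges. The maximal-path subgraph $\Gamma_D$ is the spanning subgraph of $D$ containing an edge $e$ of $D$ if and only if there are vertices $i,j$ such that $e$ lies on a path from $i$ to $j$ whose length is maximal among all paths from $i$ to $j$ in $D$. (Equivalently, $e$ is deleted iff there is a path of length greater than one in $D$ connecting the endpoints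 of $e$.) A digraph is called bipartite if its underlying undirected graph is. For vertices $i,j$ set $\langle i,j\rangle=(-1)^{\ell}$, where $\ell$ is the maximal length of a path from $i$ to $j$ in $D$, and $\langle i,j\rangle=0$ if there is no such path. An ordered pair $(i,j)$ of distinct vertices is: a zero pair if there is no path from $i$ to $j$ in $D$; a unit pair if there is a path from $i$ to $j$ and all such paths have length $1$; a composite pair if there is a path from $i$ to $j$ and a vertex $k$ with $i<k<j$ such that every path from $i$ to $j$ passes through $k$; a prime pair if it is neither a zero pair, nor a unit pair, nor a composite pair. When $\Gamma_D$ is bipartite, the pair $(i,j)$ is signable if $\langle i,j\rangle B^{-1}_{i,j}\ge 0$, and simply signable if $\langle i,j\rangle B^{-1}_{i,j}\in\{0,1\}$. *)

(* Defs.v *)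
From HB Require Import structures.
From mathcomp Require Import all_boot all_order all_algebra.
Set Implicit Arguments.
Unset Strict Implicit.
Unset Printing Implicit Defensive.
Import Order.TTheory GRing.Theory Num.Theory.
Local Open Scope nat_scope.

(* Vertices are 0, ..., n-1 instead of 1, ..., n.  Edges have an identity of
   their own, so that parallel edges, and the paths using them, are distinct. *)
Record digraph (n : nat) := Digraph {
  edge : finType;
  src : edge -> 'I_n;
  tgt : edge -> 'I_n;
  src_lt_tgt : forall e : edge, src e < tgt e
}.

Section Digraphs.
Variables (n : nat) (D : digraph n).
Implicit Types (i j k : 'I_n) (e : edge D) (p : seq (edge D)).

Definition edges_between i j : nat := #|[set e : edge D | (src e == i) && (tgt e == j)]|.

Definition simple_digraph : Prop :=
  forall e e' : edge D, src e = src e' -> tgt e = tgt e' -> e = e'.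

Definition bipartite : Prop :=
  exists c : 'I_n -> bool, forall e, c (src e) != c (tgt e).

(* A path is given by its sequence of edges; it never repeats a vertex, since
   edges are increasing. *)
Fixpoint is_path i p j : bool :=
  if p is e :: p' then (src e == i) && is_path (tgt e) p' j else i == j.

Definition vertices i p : seq 'I_n := i :: map (@tgt n D) p.

Lemma is_path_size i p j : is_path i p j -> i + size p <= j.
Proof.
elim: p i => [|e p IHp] i /=; first by move/eqP->; rewrite addn0.
case/andP=> /eqP <- /IHp; apply: leq_trans.
by rewrite addnS -addSn leq_add2r src_lt_tgt.
Qed.

Definition has_path_of_length i j (l : nat) : bool :=
  [exists p : l.-tuple (edge D), is_path i p j].

Definition connected i j : bool := [exists l : 'I_n, has_path_of_length i j l].

(* Equal to 0 if there is no path from i to j. *)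
Definition max_length i j : nat :=
  \max_(l < n | has_path_of_length i j l) l.

(* The bound l < n above loses no path. *)
Lemma has_path_of_lengthP i p j :
  is_path i p j -> size p < n /\ has_path_of_length i j (size p).
Proof.
move=> ip; split; last by apply/existsP; exists (in_tuple p).
by rewrite (leq_ltn_trans _ (ltn_ord j)) // (leq_trans _ (is_path_size ip)) ?leq_addl.
Qed.

Lemma connectedP i j : reflect (exists p, is_path i p j) (connected i j).
Proof.
apply: (iffP existsP) => [[l /existsP[p ip]]|[p /has_path_of_lengthP[lt_p hp]]].
  by exists p.
by exists (Ordinal lt_p).
Qed.

Lemma max_length_ge i p j : is_path i p j -> size p <= max_length i j.
Proof.
case/has_path_of_lengthP=> lt_p hp.
exact: (@leq_bigmax_cond _ (fun l : 'I_n => has_path_of_length i j l)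
  (fun l : 'I_n => l : nat) (Ordinal lt_p) hp).
Qed.

Lemma max_length_attained i j :
  connected i j -> exists2 p, is_path i p j & size p = max_length i j.
Proof.
case/existsP=> l0 hl0.
have [|l /existsP[p ip] ml] := @eq_bigmax_cond _
  (fun l : 'I_n => has_path_of_length i j l) (fun l : 'I_n => l : nat).
  by apply/card_gt0P; exists l0.
by exists p => //; rewrite size_tuple -ml.
Qed.

Definition on_maximal_path e : bool :=
  [exists i, exists j, exists p : (max_length i j).-tuple (edge D),
     is_path i p j && (e \in p)].

Lemma on_maximal_pathP e :
  reflect (exists i j p, [/\ is_path i p j, e \in p
             & forall q, is_path i q j -> size q <= size p])
          (on_maximal_path e).
Proof.
apply: (iffP existsP) => [[i /existsP[j /existsP[p /andP[ip ep]]]]|].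
  by exists i, j, p; split=> // q; rewrite size_tuple; apply: max_length_ge.
case=> i [j [p [ip ep pmax]]]; exists i; apply/existsP; exists j.
have sz : size p == max_length i j.
  have /max_length_attained[q iq szq] : connected i j by apply/connectedP; exists p.
  by rewrite eqn_leq max_length_ge //= -szq pmax.
by apply/existsP; exists (Tuple sz); rewrite ip.
Qed.

Definition Gamma : digraph n :=
  @Digraph n {e : edge D | on_maximal_path e}
    (fun f => src (val f)) (fun f => tgt (val f))
    (fun f => src_lt_tgt (val f)).

Definition zero_pair i j : Prop :=
  i <> j /\ ~ (exists p, is_path i p j).

Definition unit_pair i j : Prop :=
  [/\ i <> j, exists p, is_path i p j
    & forall p, is_path i p j -> size p = 1].

Definition composite_pair i j : Prop :=
  [/\ i <> j, exists p, is_path i p j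
    & exists k, i < k < j /\ forall p, is_path i p j -> k \in vertices i p].

Definition prime_pair i j : Prop :=
  [/\ i <> j, ~ zero_pair i j, ~ unit_pair i j & ~ composite_pair i j].

Local Open Scope ring_scope.

Definition Bmx : 'M[int]_n :=
  \matrix_(i, j) if i == j then 1 else (edges_between i j)%:Z.

Lemma Bmx_unit : Bmx \in unitmx.
Proof.
have tB : is_trig_mx Bmx^T.
  apply/is_trig_mxP => i j ltij; rewrite !mxE.
  rewrite (_ : (j == i) = false); last by rewrite -val_eqE /= gtn_eqF.
  rewrite /edges_between (_ : [set e | _] = set0) ?cards0 //.
  apply/setP=> e; rewrite !inE; apply/andP => -[/eqP se /eqP te].
  by have := src_lt_tgt e; rewrite se te ltnNge ltnW.
rewrite unitmxE -det_tr (det_trig tB) big1 ?unitr1 // => i _.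
by rewrite !mxE eqxx.
Qed.

Definition Binv : 'M[int]_n := invmx Bmx.

Definition invertible : Prop :=
  exists S : 'M[int]_n,
    [/\ is_diag_mx S, forall i, S i i = 1 \/ S i i = -1
      & S *m Binv *m S = map_mx (fun x : int => `|x|) Binv].

(* An edge is a pair of vertices i < j with a label smaller than |B^-1_ij|. *)
Definition parity_closure : digraph n :=
  @Digraph n
    {ij : {ij : 'I_n * 'I_n | (ij.1 < ij.2)%N}
        & 'I_(`|Binv (val ij).1 (val ij).2|%N)}
    (fun f => (val (tag f)).1) (fun f => (val (tag f)).2)
    (fun f => valP (tag f)).

Definition bracket i j : int :=
  if connected i j then (-1) ^+ max_length i j else 0.

Definition signable i j : Prop := 0 <= bracket i j * Binv i j.

Definition simply_signable i j : Prop :=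
  bracket i j * Binv i j = 0 \/ bracket i j * Binv i j = 1.

End Digraphs.

Definition simply_invertible (n : nat) (D : digraph n) : Prop :=
  invertible D /\ simple_digraph (parity_closure D).

(* Main.v *)
Require Import Defs.
From mathcomp Require Import all_boot all_order all_algebra.

(** Write [C] for the inverse of [B].  A diagonal matrix [S] of signs is the
    same thing as a 2-colouring [c] of the vertices, and [S] witnesses
    invertibility exactly when [C i j], multiplied by [-1] if [c i] and [c j]
    differ, is never negative ([invertibleP]).

    Such a colouring is forced to be a 2-colouring of [Gamma D]: an edge of
    [Gamma D] joins a unit pair ([Gamma_edge_unit_pair]), and there [C i j] is
    minus a number of edges ([Binv_unit_pair]).  Conversely, for a 2-colouring
    of [Gamma D] the sign attached to a connected pair is its bracket, because
    a longest path stays inside [Gamma D] and alternates colours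
    ([bracket_color]).  So invertibility says that [Gamma D] is bipartite and
    that every pair is signable.

    It then suffices to look at prime pairs: zero and unit pairs cause no
    trouble, and when all paths from [i] to [j] pass through [k] the path sum
    factors as [C i j = C i k * C k j] ([Binv_cut]), so that signs and absolute
    values are inherited from shorter pairs.  This reduction is the induction
    principle [pair_ind], which serves both for signs and, in the simple case,
    for the bound [`|C i j| <= 1]. *)

Set Implicit Arguments.
Unset Strict Implicit.
Unset Printing Implicit Defensive.
Import Order.TTheory GRing.Theory Num.Theory.
Local Open Scope nat_scope.

(** * Paths *)

Section Paths.
Variables (n : nat) (D : digraph n).
Implicit Types (i j k : 'I_n) (e : edge D) (p q : seq (edge D)).

Lemma is_path_cat i p q j :
  is_path i (p ++ q) j =
    is_path i p (last i (map (@tgt n D) p))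
      && is_path (last i (map (@tgt n D) p)) q j.
Proof. by elim: p i => [|e p IHp] i /=; rewrite ?eqxx // IHp andbA. Qed.

Lemma is_path_lt i p j : is_path i p j -> i <> j -> i < j.
Proof.
move=> /is_path_size /(leq_trans (leq_addr _ _)) le_ij ne_ij.
by rewrite ltn_neqAle le_ij andbT; apply/eqP => /val_inj.
Qed.

Lemma is_path_edge e : is_path (src e) [:: e] (tgt e).
Proof. by rewrite /= !eqxx. Qed.

(** A longer connection between the endpoints of an edge could replace that
    edge in any path containing it, so no such path would be maximal. *)
Lemma Gamma_edge_unit_pair e : on_maximal_path e -> unit_pair D (src e) (tgt e).
Proof.
have ne : src e <> tgt e by move=> eq_e; have := src_lt_tgt e; rewrite eq_e ltnn.
case/on_maximal_pathP=> i [j [p [ip ep pmax]]]; split=> //.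
  by exists [:: e]; apply: is_path_edge.
move=> q eq; apply/eqP; rewrite eqn_leq andbC; apply/andP; split.
  by case: q eq => //= /eqP.
case/splitPr: ep ip pmax => p1 p2.
rewrite is_path_cat /= => /and3P[ip1 /eqP last_p1 p2j] pmax.
have last_q : last (src e) (map (@tgt n D) q) = tgt e.
  by elim: q (src e) eq {ne last_p1} => [|f q IHq] x /= => [/eqP|/andP[_ /IHq]].
have /pmax : is_path i (p1 ++ q ++ p2) j.
  by rewrite is_path_cat ip1 -last_p1 /= is_path_cat last_q eq.
by rewrite !size_cat /= leq_add2l -add1n leq_add2r.
Qed.

Lemma unit_pair_on_maximal_path e :
  unit_pair D (src e) (tgt e) -> on_maximal_path e.
Proof.
case=> _ _ len1; apply/on_maximal_pathP; exists (src e), (tgt e), [:: e].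
by rewrite is_path_edge inE; split=> // q /len1->.
Qed.

(** Every ordered pair reduces to equal, zero, unit and prime pairs by
    splitting composite pairs, whose two parts span strictly smaller
    intervals.  As [P] is boolean, [P i j] may be assumed to fail, and then the
    other hypotheses make the pair prime. *)
Lemma pair_ind (P : rel 'I_n) :
    (forall i, P i i) ->
    (forall i j, zero_pair D i j -> P i j) ->
    (forall i j, unit_pair D i j -> P i j) ->
    (forall i j, prime_pair D i j -> P i j) ->
    (forall i k j, (forall p, is_path i p j -> k \in vertices i p) ->
       P i k -> P k j -> P i j) ->
  forall i j, P i j.
Proof.
move=> Prefl Pzero Punit Pprime Pcut i j.
have [m le_m] := ubnP (j - i); elim: m i j le_m => // m IHm i j le_m.
have [->|/eqP ne_ij] := eqVneq i j; first exact: Prefl.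
apply: contraT => nPij; case/negP: (nPij); apply: Pprime; split=> //.
- by move=> /Pzero; apply/negP.
- by move=> /Punit; apply/negP.
case=> _ _ [k [/andP[lt_ik lt_kj] cut]].
case/negP: nPij; apply: (Pcut _ k) => //; apply: IHm.
  by apply: (leq_trans (ltn_sub2r _ lt_kj)); first exact: ltn_trans lt_kj.
by apply: (leq_trans (ltn_sub2l _ lt_ik)); first exact: ltn_trans lt_kj.
Qed.

End Paths.

(** * Entries of the inverse matrix *)

Local Open Scope ring_scope.

Section InverseEntries.
Variables (n : nat) (D : digraph n).
Implicit Types (i j k : 'I_n) (e : edge D).

(** Reading [B C = 1] along row [i]; in terms of path sums, a nonempty path is
    classified by its first edge. *)
Lemma Binv_rec i j :
  Binv D i j = (i == j)%:R - \sum_(e : edge D | src e == i) Binv D (tgt e) j.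
Proof.
have BC : (Bmx D *m Binv D) i j = (i == j)%:R.
  by rewrite /Binv mulmxV ?Bmx_unit // mxE.
apply/eqP; rewrite -BC eq_sym subr_eq mxE (bigD1 i) //= !mxE eqxx mul1r.
rewrite (inj_eq (addrI _)) (partition_big (@tgt n D) (predC1 i)) /=.
  apply/eqP/eq_bigr => k ne_ki.
  rewrite !mxE eq_sym (negPf ne_ki) /edges_between.
  rewrite (eq_bigr (fun=> Binv D k j)); last by move=> e /andP[_ /eqP->].
  by rewrite sumr_const -mulr_natl natz cardsE.
move=> e /eqP <-; apply/eqP => eq_e.
by have := src_lt_tgt e; rewrite eq_e ltnn.
Qed.

(** Induction along edges: every vertex has larger targets only. *)
Lemma tgt_ind (P : 'I_n -> Prop) :
  (forall i, (forall e, src e = i -> P (tgt e)) -> P i) -> forall i, P i.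
Proof.
move=> step i; have [m lt_m] := ubnP (n - i)%N; elim: m i lt_m => // m IHm i lt_m.
apply: step => e eq_e; apply: IHm.
by rewrite ltnS in lt_m; apply: leq_trans lt_m; rewrite -eq_e ltn_sub2l ?src_lt_tgt ?ltn_ord.
Qed.

Lemma Binv_not_connected i j :
  ~ (exists p : seq (edge D), is_path i p j) -> Binv D i j = 0.
Proof.
elim/tgt_ind: i => i IHi nij; rewrite Binv_rec.
rewrite (_ : (i == j) = false); last first.
  by apply/eqP => eq_ij; case: nij; exists [::]; apply/eqP.
rewrite big1 ?subr0 // => e /eqP eq_e; apply: IHi => // -[p ep].
by case: nij; exists (e :: p); rewrite /= eq_e eqxx.
Qed.

Lemma Binv_refl i : Binv D i i = 1.
Proof.
rewrite Binv_rec eqxx big1 ?subr0 // => e /eqP eq_e.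
apply: Binv_not_connected => -[p /is_path_size].
move=> /(leq_trans (leq_addr _ _)).
by rewrite -eq_e leqNgt src_lt_tgt.
Qed.

(** A first edge not leading from [i] straight to [j] ends at a vertex from
    which [j] cannot be reached. *)
Lemma Binv_unit_pair i j :
  unit_pair D i j -> Binv D i j = - (edges_between D i j)%:Z.
Proof.
case=> ne_ij _ len1; rewrite Binv_rec (introF eqP ne_ij) sub0r; congr (- _).
rewrite (bigID (fun e => tgt e == j)) /= [X in _ + X]big1 ?addr0 => [|e].
  rewrite (eq_bigr (fun=> 1)) => [|e /andP[_ /eqP->]]; last exact: Binv_refl.
  by rewrite sumr_const /edges_between cardsE natz.
case/andP=> eq_e /eqP ne_e; apply: Binv_not_connected => -[p ep].
have /len1 : is_path i (e :: p) j by rewrite /= eq_e.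
by case: p ep => // /eqP.
Qed.

(** Paths from [i] to [j] are concatenations of paths from [i] to [k] and from
    [k] to [j], so the signed count is multiplicative.  The recursion on the
    first edge preserves the hypothesis as long as [i] differs from [k], and
    requires no case distinction on which pairs are connected. *)
Lemma Binv_cut i k j :
    (forall p : seq (edge D), is_path i p j -> k \in vertices i p) ->
  Binv D i j = Binv D i k * Binv D k j.
Proof.
elim/tgt_ind: i => i IHi cut.
have [->|ne_ik] := eqVneq i k; first by rewrite Binv_refl mul1r.
have ne_ij : i != j.
  apply: contraNneq ne_ik => eq_ij.
  have := cut [::]; rewrite /= eq_ij eqxx => /(_ isT).
  by rewrite inE eq_sym.
rewrite [LHS]Binv_rec [Binv D i k]Binv_rec (negPf ne_ij) (negPf ne_ik).
rewrite !sub0r mulNr mulr_suml; congr (- _); apply: eq_bigr => e /eqP eq_e.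
apply: IHi => // p ep; have := cut (e :: p).
by rewrite /= eq_e eqxx inE eq_sym (negPf ne_ik); apply.
Qed.

(** * Colourings and signs *)

Lemma path_color (c : 'I_n -> bool) i p j :
    (forall e, e \in p -> c (src e) != c (tgt e)) ->
  is_path i p j -> c i (+) c j = odd (size p).
Proof.
elim: p i => [|e p IHp] i alt /=; first by move/eqP->; rewrite addbb.
case/andP=> /eqP <- ep; rewrite -(IHp _ _ ep) => [|f fp].
  by have := alt e (mem_head _ _); case: (c (src e)) (c (tgt e)) (c j) => [] [] [].
by apply: alt; rewrite inE fp orbT.
Qed.

(** All edges of a longest path lie in [Gamma D], so colours alternate along
    it. *)
Lemma bracket_color (c : 'I_n -> bool) i j :
    (forall e, on_maximal_path e -> c (src e) != c (tgt e)) ->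
  connected D i j -> bracket D i j = (-1) ^+ (c i (+) c j).
Proof.
move=> alt conn; rewrite /bracket conn.
case: (max_length_attained conn) => p ip sz_p.
rewrite (path_color (p := p)) ?sz_p ?signr_odd // => e ep; apply: alt.
apply/on_maximal_pathP; exists i, j, p; split=> // q.
by rewrite sz_p; apply: max_length_ge.
Qed.

Lemma bipartite_GammaP :
  bipartite (Gamma D) <->
  exists c : 'I_n -> bool, forall e, on_maximal_path e -> c (src e) != c (tgt e).
Proof.
split=> -[c alt]; exists c; last by case=> e max_e; apply: alt.
by move=> e max_e; apply: (alt (Sub e max_e)).
Qed.

Lemma invertibleP :
  invertible D <->
  exists c : 'I_n -> bool, forall i j, 0 <= (-1) ^+ (c i (+) c j) * Binv D i j.
Proof.
split=> [[S [/is_diag_mxP diagS signS eqS]]|[c pos]].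
  exists (fun i => S i i == -1) => i j.
  have sgn k : S k k = (-1) ^+ (S k k == -1) by case: (signS k) => ->.
  have SE : S = diag_mx (\row_k S k k).
    apply/matrixP => k l; rewrite !mxE.
    by have [->|ne_kl] := eqVneq k l; [rewrite mulr1n | rewrite mulr0n diagS].
  have := congr1 (fun A : 'M_n => A i j) eqS.
  rewrite [in X in X -> _]SE mul_diag_mx mul_mx_diag !mxE => eq_ij.
  by rewrite signr_addb -!sgn mulrAC eq_ij normr_ge0.
exists (diag_mx (\row_k (-1) ^+ c k)); split=> [|i|]; first exact: diag_mx_is_diag.
  by rewrite !mxE eqxx mulr1n; case: (c i); [right|left].
apply/matrixP => i j; rewrite mul_diag_mx mul_mx_diag !mxE mulrAC -signr_addb.
by rewrite -[LHS]ger0_norm ?pos // normrMsign.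
Qed.

(** An edge of [Gamma D] makes [Binv] strictly negative, which excludes equal
    colours. *)
Lemma sign_color_Gamma (c : 'I_n -> bool) :
    (forall i j, 0 <= (-1) ^+ (c i (+) c j) * Binv D i j) ->
  forall e, on_maximal_path e -> c (src e) != c (tgt e).
Proof.
move=> pos e /Gamma_edge_unit_pair/Binv_unit_pair Ce.
apply/negP => /eqP eq_c; have := pos (src e) (tgt e).
rewrite eq_c addbb mul1r Ce oppr_ge0 lez_nat leqNgt => /negP; apply.
by apply/card_gt0P; exists e; rewrite inE !eqxx.
Qed.

(** The colour condition holds for all pairs once it holds for prime ones,
    where it is signability. *)
Lemma signable_sign_color (c : 'I_n -> bool) :
    (forall e, on_maximal_path e -> c (src e) != c (tgt e)) ->
    (forall i j, prime_pair D i j -> signable D i j) ->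
  forall i j, 0 <= (-1) ^+ (c i (+) c j) * Binv D i j.
Proof.
move=> alt prime_sgn.
apply: (@pair_ind n D) => [i|i j [_ nij]|i j uij|i j pij|i k j cut].
- by rewrite addbb Binv_refl.
- by rewrite Binv_not_connected // mulr0.
- have [_ [p ip] len1] := uij.
  have max_p e : e \in p -> on_maximal_path e.
    move=> ep; apply/on_maximal_pathP; exists i, j, p; split=> // q /len1->.
    by rewrite (len1 p).
  rewrite (path_color (p := p)) // => [|e /max_p /alt //].
  by rewrite (len1 _ ip) Binv_unit_pair // mulN1r opprK.
- have [_ nz _ _] := pij.
  have [conn|nconn] := boolP (connected D i j).
    by rewrite -bracket_color //; apply: prime_sgn.
  rewrite Binv_not_connected ?mulr0 // => path_ij.
  by case/negP: nconn; apply/connectedP.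
move=> pos_ik pos_kj; rewrite (Binv_cut cut).
have -> : c i (+) c j = (c i (+) c k) (+) (c k (+) c j).
  by rewrite addbA -[_ (+) c k]addbA addbb addbF.
by rewrite signr_addb mulrACA mulr_ge0.
Qed.

Lemma sign_color_signable (c : 'I_n -> bool) i j :
    (forall i j, 0 <= (-1) ^+ (c i (+) c j) * Binv D i j) ->
  connected D i j -> bracket D i j * Binv D i j = `|Binv D i j|.
Proof.
move=> pos conn; rewrite (bracket_color (sign_color_Gamma pos)) //.
by rewrite -[LHS]ger0_norm ?pos // normrMsign.
Qed.

Lemma prime_pair_connected i j : prime_pair D i j -> connected D i j.
Proof.
case=> ne_ij nz _ _; apply: contraT => nconn; case: nz; split=> // path_ij.
by case/negP: nconn; apply/connectedP.
Qed.

Lemma invertible_iff :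
  invertible D <->
    bipartite (Gamma D) /\
    (forall i j, prime_pair D i j -> signable D i j).
Proof.
split=> [/invertibleP[c pos]|[/bipartite_GammaP[c alt] prime_sgn]].
  split; first by apply/bipartite_GammaP; exists c; apply: sign_color_Gamma.
  move=> i j /prime_pair_connected conn.
  by rewrite /signable (sign_color_signable pos) ?normr_ge0.
by apply/invertibleP; exists c; apply: signable_sign_color.
Qed.

(** * Simple inverses *)

Lemma simple_parity_closureP :
  simple_digraph (parity_closure D) <->
  forall i j : 'I_n, (i < j)%N -> `|Binv D i j| <= 1.
Proof.
split=> [simp i j lt_ij | le1].
  rewrite -abszE lez_nat leqNgt; apply/negP => gt1.
  pose ij : {ij : 'I_n * 'I_n | (ij.1 < ij.2)%N} := Sub (i, j) lt_ij.
  pose f (t : 'I_(`|Binv D (val ij).1 (val ij).2|%N)) : edge (parity_closure D) :=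
    existT _ ij t.
  have := simp (f (Ordinal (ltnW gt1))) (f (Ordinal gt1)) erefl erefl.
  by move=> /(congr1 (fun x => nat_of_ord (tagged x))).
move=> [x t] [y t'] /= eq_i eq_j.
have eq_xy : x = y.
  by apply: val_inj; apply/eqP; rewrite -pair_eqE /= /pair_eq eq_i eq_j !eqxx.
case: y / eq_xy t' {eq_i eq_j} => t'; congr existT; apply: val_inj => /=.
have := le1 _ _ (valP x); rewrite -abszE lez_nat => le1_x.
have := ltn_ord t; have := ltn_ord t'; rewrite /= => lt_t' lt_t.
move: (leq_trans lt_t le1_x) (leq_trans lt_t' le1_x).
by rewrite !ltnS !leqn0 => /eqP-> /eqP->.
Qed.

Lemma simple_GammaP :
  simple_digraph (Gamma D) <->
  forall i j, unit_pair D i j -> (edges_between D i j <= 1)%N.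
Proof.
split=> [simp i j uij | le1 [e max_e] [e' max_e'] /= eq_s eq_t].
  have max_of e : src e = i -> tgt e = j -> on_maximal_path e.
    by move=> se te; apply: unit_pair_on_maximal_path; rewrite se te.
  apply/card_le1P => e; rewrite inE => /andP[/eqP se /eqP te] e'.
  rewrite !inE; apply/idP/eqP => [/andP[/eqP se' /eqP te']|->]; last first.
    by rewrite se te !eqxx.
  have := simp (Sub e (max_of e se te)) (Sub e' (max_of e' se' te')).
  by rewrite /= se te se' te' => /(_ erefl erefl) /(congr1 val).
apply: val_inj => /=; have := le1 _ _ (Gamma_edge_unit_pair max_e).
by move/card_le1_eqP; apply; rewrite inE ?eq_s ?eq_t !eqxx.
Qed.

Lemma simply_invertible_iff :
  simply_invertible D <->
    simple_digraph (Gamma D) /\ bipartite (Gamma D) /\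
    (forall i j, prime_pair D i j -> simply_signable D i j).
Proof.
split=> [[inv /simple_parity_closureP le1]|].
  split; first apply/simple_GammaP=> i j uij.
    have [ne_ij [p ip] _] := uij; have := le1 i j (is_path_lt ip ne_ij).
    by rewrite Binv_unit_pair // normrN.
  split=> [|i j pij]; first by case/invertible_iff: inv.
  have conn := prime_pair_connected pij; have [ne_ij _ _ _] := pij.
  case/connectedP: (conn) => p ip; have /invertibleP[c pos] := inv.
  rewrite /simply_signable (sign_color_signable pos conn) -abszE.
  have := le1 i j (is_path_lt ip ne_ij); rewrite -abszE lez_nat.
  by case: absz => [|[|]] // _; [left|right].
case=> /simple_GammaP le1 [bip prime_sgn]; split.
  apply/invertible_iff; split=> // i j /prime_sgn.
  by rewrite /signable => -[->|->].
apply/simple_parity_closureP=> i j _; move: i j.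
apply: (@pair_ind n D) => [i|i j [_ nij]|i j uij|i j pij|i k j cut].
- by rewrite Binv_refl.
- by rewrite Binv_not_connected.
- by rewrite Binv_unit_pair // normrN lez_nat le1.
- have conn := prime_pair_connected pij.
  have := prime_sgn _ _ pij; rewrite /simply_signable /bracket conn.
  by rewrite -(normrMsign (max_length D i j)) -signr_odd => -[->|->].
move=> le1_ik le1_kj; rewrite (Binv_cut cut) normrM.
exact: mulr_ile1.
Qed.

End InverseEntries.

Theorem theorem3p15 (n : nat) (D : digraph n) :
  (invertible D <->
     bipartite (Gamma D) /\
     (forall i j : 'I_n, prime_pair D i j -> signable D i j)) /\
  (simply_invertible D <->
     simple_digraph (Gamma D) /\ bipartite (Gamma D) /\
     (forall i j : 'I_n, prime_pair D i j -> simply_signable D i j)).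
Proof. by split; [apply: invertible_iff | apply: simply_invertible_iff]. Qed.
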